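(* For every integer $m_T\ge1$, $$\alpha(m_T)=\max_{I\in\mathcal{I}(m_T)}\frac{LP[I]}{OPT[I]},$$ where $\mathcal{I}(m_T)$ is the set of instances of \textsc{MaxToll} with exactly $m_T$ toll arcs and $OPT[I]>0$, and $LP[I]$, $OPT[I]$ denote the upper bound and the optimal value of instance $I$.
   Context: \textsc{MaxToll} instance: a directed multigraph $G=(V,A)$ with $A=A_T\cup A_U$ partitioned into toll arcs ($|A_T|=m_T$) and toll-free arcs, fixed costs $c:A_T\to\mathbf{N}$, $d:A_U\to\mathbf{N}$, and vertices $s,t$ such that there is an $s$–$t$ path using only toll-free arcs. Under a nonnegative toll vector $T$ a toll arc $e$ costs $c(e)+T(e)$ and a toll-free arc $e$ costs $d(e)$. $OPT[I]$ is the maximum of $\sum_{e\in A_T\cap P}T(e)$ over nonnegative toll vectors $T$ and simple $s$–$t$ paths $P$ that are shortest with respect to the costs induced by $T$. $LP[I]=\mathcal{L}_\infty-\mathcal{L}_0$, where $\mathcal{L}_\infty$ is the length of a shortest $s$–$t$ path using only toll-free arcs and $\mathcal{L}_0$ is the length of a shortest $s$–$t$ path when all tolls are zero. $\alpha(1)=1$ and, for $k\ge2$, $\alpha(k)=\frac12\max\{1+\alpha(i)+\alpha(j):\ 0<i\le j<k,\ i+j\le k\}$. *)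

(* Defs.v *)
From Stdlib Require Import Reals.
From mathcomp Require Import all_boot.
Set Implicit Arguments.
Local Open Scope R_scope. Unset Strict Implicit. Unset Printing Implicit Defensive.

(* A MaxToll instance: a finite directed multigraph (arcs are a finite type,
   each arc has a source and a target, parallel arcs allowed), a partition of
   the arcs into toll arcs ([toll a = true]) and toll-free arcs, a fixed
   natural cost for every arc (c on toll arcs, d on toll-free arcs), and s, t. *)
Record instance := Instance {
  V : finType;
  Arc : finType;
  src : Arc -> V;
  dst : Arc -> V;
  toll : Arc -> bool;
  cost : Arc -> nat;
  s_of : V;
  t_of : V }.

Section Inst.
Variable I : instance.

Definition mT : nat := #|[pred a : Arc I | toll a]|%N.

Fixpoint is_walk (u v : V I) (p : seq (Arc I)) : bool :=
  match p with
  | [::] => u == v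
  | a :: p' => (src a == u) && is_walk (dst a) v p'
  end.

Definition st_path (p : seq (Arc I)) : bool :=
  is_walk (s_of I) (t_of I) p && uniq (s_of I :: map (@dst I) p).

Definition toll_free_path (p : seq (Arc I)) : bool :=
  st_path p && all (fun a => ~~ toll a) p.

Definition valid_instance : Prop := exists p, toll_free_path p.

Definition sumR (l : seq R) : R := foldr Rplus 0 l.

Definition arc_cost (T : Arc I -> R) (a : Arc I) : R :=
  if toll a then (INR (cost a) + T a) else INR (cost a).

Definition path_cost (T : Arc I -> R) (p : seq (Arc I)) : R :=
  sumR (map (arc_cost T) p).

Definition revenue (T : Arc I -> R) (p : seq (Arc I)) : R :=
  sumR (map T (filter (@toll I) p)).

Definition nonneg_tolls (T : Arc I -> R) : Prop :=
  forall a, toll a -> (0 <= T a).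

Definition shortest (T : Arc I -> R) (p : seq (Arc I)) : Prop :=
  st_path p /\ forall q, st_path q -> (path_cost T p <= path_cost T q).

Definition feasible (T : Arc I -> R) (p : seq (Arc I)) : Prop :=
  nonneg_tolls T /\ shortest T p.

Definition is_OPT (v : R) : Prop :=
  (exists T p, feasible T p /\ revenue T p = v) /\
  (forall T p, feasible T p -> (revenue T p <= v)).

Definition zero_tolls : Arc I -> R := fun _ => 0.

Definition is_Linf (L : R) : Prop :=
  (exists p, toll_free_path p /\ path_cost zero_tolls p = L) /\
  (forall p, toll_free_path p -> (L <= path_cost zero_tolls p)).

Definition is_L0 (L : R) : Prop :=
  (exists p, st_path p /\ path_cost zero_tolls p = L) /\
  (forall p, st_path p -> (L <= path_cost zero_tolls p)).

End Inst.

Definition alpha_pairs (k : nat) : seq (nat * nat) :=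
  [seq ij <- [seq (i, j) | i <- iota 1 k, j <- iota 1 k]
     | [&& 0 < ij.1, ij.1 <= ij.2, ij.2 < k & ij.1 + ij.2 <= k]%N].

Definition alpha_step (a : nat -> R) (k : nat) : R :=
  if (k <= 1)%N then 1
  else (/ 2 * foldr Rmax (1 + a 1%N + a 1%N)
                 [seq (1 + a ij.1 + a ij.2) | ij <- alpha_pairs k]).

(* alphas n = [:: alpha 1; ...; alpha n] *)
Fixpoint alphas (n : nat) : seq R :=
  match n with
  | 0 => [::]
  | n'.+1 => let l := alphas n' in rcons l (alpha_step (fun i => nth 0 l i.-1) n)
  end.

Definition alpha (k : nat) : R := nth 0 (alphas k) k.-1.

(* Main.v *)
(** Let L(P) be the cost of a path P at zero tolls and LP(P) = Linf - L(P).

    Upper bound.  Let P be shortest, at zero tolls, among the walks whose toll arcs lie on P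
    (the other toll arcs can be priced out).  Raise the tolls along P one at a time, from the
    last arc to the first, as much as possible while P stays shortest.  Each toll arc is then
    bypassed by a toll-free detour of the same cost as the segment of P it replaces, and no
    toll is charged on that segment before the arc.  Choosing detours that reach as far as
    possible gives a cover of the toll arcs of P by a chain of detours in which only
    consecutive ones overlap, with zero tolls on the overlaps.  Following every other detour
    of the chain gives two paths P1, P2 with disjoint sets of toll arcs, contained in that of
    P, such that 2 LP(P) <= Rev(P) + LP(P1) + LP(P2), where Rev(P) <= OPT; this is the
    recursion that defines alpha.

    Tightness.  Take i + j = k with 2 alpha(k) = 1 + alpha(i) + alpha(j), compose tight
    instances for i and j in series, and add a toll-free detour around each of the two, of
    costs x and y with x + y = OPT and x + OPT alpha(j) = OPT alpha(i) + y = OPT alpha(k).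
    A path through both parts earns at most x + y, a path using a detour at most OPT.  That
    OPT is attained follows from the upper bound. *)
Require Import Defs.
From Stdlib Require Import Reals Lra Classical.
From mathcomp Require Import all_boot.
From mathcomp Require Import zify.
(* mathcomp's ring_scope, loaded by zify, would otherwise keep the key R *)
Delimit Scope R_scope with R.
Set Implicit Arguments.
Unset Strict Implicit.
Unset Printing Implicit Defensive.

(** * The recursion for alpha and its monotonicity *)

Lemma size_alphas n : size (alphas n) = n.
Proof. by elim: n => //= n IH; rewrite size_rcons IH. Qed.

Lemma alphaS n :
  alpha n.+1 = alpha_step (fun i => nth 0%R (alphas n) i.-1) n.+1.
Proof. by rewrite /alpha /= nth_rcons size_alphas ltnn eqxx. Qed.

Lemma nth_alphas n i : (i < n)%N -> nth 0%R (alphas n) i = alpha i.+1.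
Proof.
elim: n => // n IH; rewrite ltnS leq_eqVlt => /orP[/eqP->|lt_in].
  by rewrite alphaS /= nth_rcons size_alphas ltnn eqxx.
by rewrite /= nth_rcons size_alphas lt_in IH.
Qed.

Lemma alpha_pairsP k i j :
  reflect [/\ 0 < i, i <= j, j < k & i + j <= k]%N ((i, j) \in alpha_pairs k).
Proof.
rewrite mem_filter /=; apply: (iffP andP) => [[/and4P[]]//|[i0 ij jk ijk]].
split; first exact/and4P.
by apply/allpairsP; exists (i, j); rewrite !mem_iota /=; split => //; lia.
Qed.

Lemma alpha1 : alpha 1 = 1%R.
Proof. by []. Qed.

(** The seed of the fold is the value of the pair (1, 1), admissible for every k >= 2, so the fold
    is the maximum over the admissible pairs. *)
Lemma alpha_rec k : (1 < k)%N ->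
  alpha k = (/ 2 * foldr Rmax (1 + alpha 1 + alpha 1)
    [seq 1 + alpha ij.1 + alpha ij.2 | ij <- alpha_pairs k])%R.
Proof.
case: k => [|k] // k1; rewrite alphaS /alpha_step ifF; last by lia.
rewrite nth_alphas; last by lia.
congr (/ 2 * foldr Rmax _ _)%R; apply/eq_in_map => -[i j] /alpha_pairsP[] /= *.
by rewrite !nth_alphas ?prednK //; lia.
Qed.

Lemma foldr_Rmax_ub (s : seq R) x0 x :
  List.In x (x0 :: s) -> (x <= foldr Rmax x0 s)%R.
Proof.
elim: s => [|y s IH] /=; first by case=> // ->; lra.
move=> H; have [->|Hx] : x = y \/ List.In x (x0 :: s).
- by case: H => [|[]] H; [right; left|left|right; right].
- exact: Rmax_l.
- exact: Rle_trans (IH Hx) (Rmax_r _ _).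
Qed.

Lemma foldr_Rmax_in (s : seq R) x0 : List.In (foldr Rmax x0 s) (x0 :: s).
Proof.
elim: s => [|y s IH] /=; first by left.
change (List.In (Rmax y (foldr Rmax x0 s)) [:: x0, y & s]).
rewrite /Rmax; case: Rle_dec => _; last by right; left.
by case: IH => H; [left|right; right].
Qed.

Lemma In_map_mem (X : eqType) (f : X -> R) (s : seq X) y :
  List.In y (map f s) <-> exists2 x, x \in s & y = f x.
Proof.
elim: s => [|x s IH] /=; first by split=> // -[].
split=> [[<-|Hy]|[z]].
- by exists x; rewrite ?mem_head.
- by have [z zs ->] := proj1 IH Hy; exists z; rewrite // inE zs orbT.
- rewrite inE => /orP[/eqP-> ->|zs yE]; first by left.
  by right; apply: (proj2 IH); exists z.
Qed.

Lemma alpha_ge i j k : (0 < i)%N -> (0 < j)%N -> (i + j <= k)%N ->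
  (1 + alpha i + alpha j <= 2 * alpha k)%R.
Proof.
wlog le_ij : i j / (i <= j)%N => [H i0 j0 ijk|i0 j0 ijk].
  case: (leqP i j) => ij; first exact: H.
  by have := H j i (ltnW ij) j0 i0; rewrite addnC => /(_ ijk); lra.
rewrite (@alpha_rec k); last by lia.
rewrite -Rmult_assoc Rinv_r ?Rmult_1_l; last by lra.
apply: foldr_Rmax_ub; right; apply/In_map_mem; exists (i, j) => //.
by apply/alpha_pairsP; split; lia.
Qed.

Lemma alpha_attained k : (1 < k)%N ->
  exists i j, [/\ (0 < i)%N, (i <= j)%N, (i + j <= k)%N
                & (2 * alpha k = 1 + alpha i + alpha j)%R].
Proof.
move=> k1; rewrite (@alpha_rec k) // -Rmult_assoc Rinv_r ?Rmult_1_l; last by lra.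
set s := map _ _; case: (foldr_Rmax_in s (1 + alpha 1 + alpha 1)%R) => [<-|].
  by exists 1%N, 1%N.
case/In_map_mem=> -[i j] /alpha_pairsP[i0 ij jk ijk] ->.
by exists i, j.
Qed.

(** For k >= 2, a pair attaining the maximum for k is still admissible for k + 1. *)
Lemma alpha_leS k : (0 < k)%N -> (alpha k <= alpha k.+1)%R.
Proof.
case: (leqP k 1) => [k1 k0|k1 _].
  have -> : k = 1%N by lia.
  by have := @alpha_ge 1 1 2 isT isT isT; rewrite alpha1; lra.
have [i [j [i0 ij ijk ak]]] := alpha_attained k1.
by have := @alpha_ge i j k.+1 i0; rewrite -ak => /(_ _ _)/Rmult_le_reg_l; apply; lia || lra.
Qed.

Lemma alpha_le i j : (0 < i)%N -> (i <= j)%N -> (alpha i <= alpha j)%R.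
Proof.
move=> i0; elim: j => [|j IH]; first by lia.
rewrite leq_eqVlt => /orP[/eqP->|lt_ij]; first exact: Rle_refl.
by apply: Rle_trans (IH lt_ij) _; apply: alpha_leS; lia.
Qed.

Lemma alpha_ge1 k : (0 < k)%N -> (1 <= alpha k)%R.
Proof. exact: (@alpha_le 1). Qed.

(** Monotonicity lets j grow to k - i; a tight instance composed of two parts must have exactly k
    toll arcs. *)
Lemma alpha_split k : (1 < k)%N ->
  exists i j, [/\ (0 < i)%N, (i <= j)%N, (i + j = k)%N
                & (2 * alpha k = 1 + alpha i + alpha j)%R].
Proof.
move=> k1; have [i [j [i0 ij ijk ak]]] := alpha_attained k1.
exists i, (k - i)%N; split; [by []|lia|lia|].
have Hge := @alpha_ge i (k - i) k i0.
have Hle : (alpha j <= alpha (k - i))%R by apply: alpha_le; lia.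
have {}Hge : (1 + alpha i + alpha (k - i) <= 2 * alpha k)%R by apply: Hge; lia.
lra.
Qed.

(** * Extremal choices for predicates decided classically *)

Lemma ex_last_holding (Q : nat -> Prop) n :
  Q 0 -> ~ Q n -> exists k, Q k /\ ~ Q k.+1.
Proof.
move=> Q0; elim: n => [//|n IH] Qn.
by case: (classic (Q n)) => [|/IH//]; exists n.
Qed.

Lemma ex_greatest (Q : nat -> Prop) n k0 : (k0 <= n)%N -> Q k0 ->
  exists k, [/\ (k0 <= k <= n)%N, Q k & forall k', (k' <= n)%N -> Q k' -> (k' <= k)%N].
Proof.
elim: n => [|n IH] kn Qk0.
  by exists k0; split=> //; lia.
case: (classic (Q n.+1)) => [Qn|nQn]; first by exists n.+1; split=> //; lia.
have kn' : (k0 <= n)%N.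
  by move: kn; rewrite leq_eqVlt => /orP[/eqP E|//]; case: nQn; rewrite -E.
have [k [k_n Qk maxk]] := IH kn' Qk0.
exists k; split=> //; first by lia.
move=> k'; rewrite leq_eqVlt => /orP[/eqP->//|]; exact: maxk.
Qed.

Lemma ex_minimizer (X : Type) (Q : X -> Prop) (f : X -> nat) x0 : Q x0 ->
  exists x, Q x /\ forall y, Q y -> (f x <= f y)%N.
Proof.
have [n] := ubnP (f x0); elim: n x0 => // n IH x0 lt_x0 Qx0.
case: (classic (exists2 y, Q y & (f y < f x0)%N)) => [[y Qy lt_y]|no].
  by apply: IH Qy; lia.
exists x0; split=> // y Qy; rewrite leqNgt; apply/negP=> lt_y.
by apply: no; exists y.
Qed.

(** * Walks, their segments, and costs under natural tolls *)

Section Walks.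

Variable I : instance.
Implicit Types (u v : V I) (p q : seq (Arc I)) (T : Arc I -> nat).

Definition base_cost p := (\sum_(a <- p) cost a)%N.
(** Fixed costs are integers, so tolls can be kept natural: the largest raise that keeps a path
    shortest is then found in unit steps. *)
Definition nat_revenue T p := (\sum_(a <- p | toll a) T a)%N.
Definition nat_cost T p := (base_cost p + nat_revenue T p)%N.
Definition free p := all (fun a => ~~ toll a) p.
Definition tolls_within p q := forall a, a \in q -> toll a -> a \in p.
Definition simple u p := uniq (u :: map (@dst I) p).

Lemma base_cost_cat p q : base_cost (p ++ q) = (base_cost p + base_cost q)%N.
Proof. exact: big_cat. Qed.

Lemma nat_revenue_cat T p q :
  nat_revenue T (p ++ q) = (nat_revenue T p + nat_revenue T q)%N.
Proof. exact: big_cat. Qed.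

Lemma nat_revenue_free T p : free p -> nat_revenue T p = 0%N.
Proof.
move=> fp; rewrite /nat_revenue big_seq_cond big1 // => a /andP[ap ta].
by move/allP: fp => /(_ a ap); rewrite ta.
Qed.

Lemma nat_revenue0 p : nat_revenue (fun=> 0%N) p = 0%N.
Proof. exact: big1_eq. Qed.

Lemma nat_revenueD1 T e k p : toll e ->
  nat_revenue (fun a => T a + (a == e) * k)%N p =
  (nat_revenue T p + count_mem e p * k)%N.
Proof.
move=> te; rewrite /nat_revenue big_split /=; congr addn.
elim: p => [|a p IH]; first by rewrite big_nil.
rewrite big_cons /= IH mulnDl; case: ifP => // ta.
by case: eqP => [E|] //; move: te; rewrite -E ta.
Qed.

Lemma base_cost_subseq p q : subseq p q -> (base_cost p <= base_cost q)%N.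
Proof.
elim: q p => [|b q IH] [|a p] //=; first by rewrite /base_cost big_nil.
rewrite {2}/base_cost big_cons; case: eqP => [->|_] /IH H.
  by rewrite /base_cost big_cons leq_add2l.
by apply: leq_trans H _; apply: leq_addl.
Qed.

Lemma nat_revenue_subseq T p q :
  subseq p q -> (nat_revenue T p <= nat_revenue T q)%N.
Proof.
elim: q p => [|b q IH] [|a p] //=; first by rewrite /nat_revenue big_nil.
rewrite {2}/nat_revenue big_cons; case: eqP => [->|_] /IH H.
  by rewrite /nat_revenue big_cons; case: ifP => _ //; rewrite leq_add2l.
by apply: leq_trans H _; case: ifP => // _; apply: leq_addl.
Qed.

Lemma walk_cat u v w p q :
  is_walk u v p -> is_walk v w q -> is_walk u w (p ++ q).
Proof.
elim: p u => [u /eqP->//|a p IH u] /= /andP[-> /IH H] /H->; exact: isT.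
Qed.

(** Vertices of a walk are numbered from 0 to [size p]; the arc of index r joins vertices r and r +
    1, and lies in [seg p i j] when i <= r < j. *)
Definition vtx u p i := nth u (u :: map (@dst I) p) i.

Definition seg p i j := drop i (take j p).

Lemma take_seg p i j : (i <= j)%N -> take j p = take i p ++ seg p i j.
Proof. by move=> ij; rewrite -(cat_take_drop i (take j p)) take_takel. Qed.

Lemma drop_seg p i j : (i <= j)%N -> drop i p = seg p i j ++ drop j p.
Proof.
move=> ij; have /eqP := cat_take_drop i p.
rewrite -{3}(cat_take_drop j p) (take_seg _ ij) -catA eqseq_cat //.
by case/andP=> _ /eqP.
Qed.

Lemma walk_take_drop u v p i : (i <= size p)%N -> is_walk u v p ->
  is_walk u (vtx u p i) (take i p) /\ is_walk (vtx u p i) v (drop i p).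
Proof.
elim: p u i => [|a p IH] u [|i] //=; rewrite ?eqxx // => ip /andP[sa wp].
have [] := IH (dst a) i ip wp.
have -> : vtx u (a :: p) i.+1 = vtx (dst a) p i.
  by rewrite /vtx /=; apply: set_nth_default; rewrite /= size_map.
by rewrite sa.
Qed.

Lemma walk_inj_end u v w p : is_walk u v p -> is_walk u w p -> v = w.
Proof.
elim: p u => [|a p IH] u /=; first by move=> /eqP-> /eqP->.
by move=> /andP[_ H1] /andP[_ H2]; apply: IH H1 H2.
Qed.

Lemma vtx_size u v p : is_walk u v p -> vtx u p (size p) = v.
Proof.
move=> wp; have [] := @walk_take_drop u v p (size p) (leqnn _) wp.
by rewrite take_size => wp' _; apply: walk_inj_end wp' wp.
Qed.

Lemma walk_catl u v w p q :
  is_walk u v p -> is_walk u w (p ++ q) -> is_walk v w q.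
Proof.
elim: p u => [|a p IH] u /=; first by move=> /eqP->.
by move=> /andP[_ H1] /andP[_ H2]; apply: IH H1 H2.
Qed.

Lemma walk_seg u v p i j : (i <= j <= size p)%N -> is_walk u v p ->
  is_walk (vtx u p i) (vtx u p j) (seg p i j).
Proof.
move=> /andP[ij jp] wp; have [wi _] := walk_take_drop (leq_trans ij jp) wp.
have [wj _] := walk_take_drop jp wp.
by apply: walk_catl wi _; rewrite -take_seg.
Qed.

Lemma vtx_src u v p a : is_walk u v p -> a \in p -> src a = vtx u p (index a p).
Proof.
elim: p u => //= b p IH u /andP[/eqP sb wp]; rewrite inE eq_sym.
case: eqP => [<-|_] //= ap.
rewrite (IH _ wp ap) /vtx /=; apply: set_nth_default.
by rewrite /= size_map ltnS index_size.
Qed.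

Lemma vtx_dst u p a : a \in p -> dst a = vtx u p (index a p).+1.
Proof. by move=> ap; rewrite /vtx /= (nth_map a) ?index_mem // nth_index. Qed.

Lemma vtx_inj u p i j : simple u p -> (i <= size p)%N -> (j <= size p)%N ->
  vtx u p i = vtx u p j -> i = j.
Proof.
move=> sp ip jp /eqP.
by rewrite /vtx nth_uniq //= ?size_map ?ltnS // => /eqP.
Qed.

Lemma simple_uniq u p : simple u p -> uniq p.
Proof. by case/andP=> _ /map_uniq. Qed.

Lemma walk_simplify u v p : is_walk u v p ->
  exists q, [/\ is_walk u v q, simple u q & subseq q p].
Proof.
elim: p u => [|a p IH] u /=; first by move=> ?; exists [::].
case/andP=> /eqP sa /IH[q [wq sq sub]].
case: (boolP (u \in dst a :: map (@dst I) q)) => [uq|nuq]; last first.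
  exists (a :: q); rewrite /= sa eqxx wq eqxx; split=> //.
  by apply/andP; split; [exact: nuq | exact: sq].
(* The part of the tail before u recurs closes a loop and is cut off. *)
pose i := index u (dst a :: map (@dst I) q).
have ui : vtx (dst a) q i = u by rewrite /vtx nth_index.
have iq : (i <= size q)%N by have := uq; rewrite -index_mem /= size_map.
exists (drop i q); split.
- by rewrite -{1}ui; case: (walk_take_drop iq wq).
- have /(drop_uniq i) : uniq (dst a :: map (@dst I) q) by [].
  rewrite (drop_nth (dst a)) /= ?size_map ?ltnS //.
  by rewrite -/(vtx _ _ _) ui /= -map_drop.
- by apply: subseq_trans (drop_subseq _ _) (subseq_trans sub (subseq_cons _ _)).
Qed.


(** * Paths that are shortest relative to their own toll arcs, and their detours *)

(** Competitors are walks, so that pieces can be concatenated freely. Toll arcs off p are excluded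
    because they can be made prohibitively dear, see [feasible_nat]. *)
Definition toll_shortest T u v p :=
  forall q, is_walk u v q -> tolls_within p q -> (nat_cost T p <= nat_cost T q)%N.

Lemma nat_cost_cat T p q : nat_cost T (p ++ q) = (nat_cost T p + nat_cost T q)%N.
Proof. rewrite /nat_cost base_cost_cat nat_revenue_cat; lia. Qed.

Lemma nat_cost_split T p i j : (i <= j)%N ->
  nat_cost T p =
  (nat_cost T (take i p) + nat_cost T (seg p i j) + nat_cost T (drop j p))%N.
Proof.
by move=> ij; rewrite -{1}(cat_take_drop j p) (take_seg _ ij) !nat_cost_cat.
Qed.

Lemma nat_cost_split1 T p i :
  nat_cost T p = (nat_cost T (take i p) + nat_cost T (drop i p))%N.
Proof. by rewrite -nat_cost_cat cat_take_drop. Qed.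

Lemma nat_cost_free T p : free p -> nat_cost T p = base_cost p.
Proof. by move=> fp; rewrite /nat_cost nat_revenue_free // addn0. Qed.

Lemma tolls_within_cat p q r :
  tolls_within p q -> tolls_within p r -> tolls_within p (q ++ r).
Proof. by move=> Hq Hr a; rewrite mem_cat => /orP[/Hq|/Hr]. Qed.

Lemma tolls_within_free p q : free q -> tolls_within p q.
Proof. by move=> /allP fq a /fq /negbTE->. Qed.

Lemma tolls_within_sub p q : {subset q <= p} -> tolls_within p q.
Proof. by move=> sub a /sub. Qed.

Lemma tolls_within_catl p q r : tolls_within p (q ++ r) -> tolls_within p q.
Proof. by move=> H a aq; apply: H; rewrite mem_cat aq. Qed.

Lemma tolls_within_catr p q r : tolls_within p (q ++ r) -> tolls_within p r.
Proof. by move=> H a aq; apply: H; rewrite mem_cat aq orbT. Qed.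

(** When p is simple and [toll_shortest], a detour certifies that no toll inside the segment can be
    raised: replacing the segment by w would then be cheaper. *)
Definition detour T u p i j w :=
  [/\ (i <= j <= size p)%N, is_walk (vtx u p i) (vtx u p j) w, free w
    & base_cost w = nat_cost T (seg p i j)].

Definition tight T u p i j := exists w, detour T u p i j w.

Section OnePath.

Variables (u v : V I) (p : seq (Arc I)).
Hypotheses (wp : is_walk u v p) (sp : simple u p).

(** Substituting w for its segment gives a competitor of p. *)
Lemma free_ge T w i j : toll_shortest T u v p -> (i <= j <= size p)%N ->
  is_walk (vtx u p i) (vtx u p j) w -> free w ->
  (nat_cost T (seg p i j) <= base_cost w)%N.
Proof.
move=> shp ijp ww fw; have /andP[ij jp] := ijp.
have [wi _] := walk_take_drop (leq_trans ij jp) wp.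
have [_ wj] := walk_take_drop jp wp.
have := shp _ (walk_cat wi (walk_cat ww wj)); rewrite !nat_cost_cat (nat_cost_free _ fw).
rewrite (nat_cost_split T p ij) => H.
suff: tolls_within p (take i p ++ w ++ drop j p) by move/H; lia.
apply: tolls_within_cat; first exact/tolls_within_sub/mem_take.
by apply: tolls_within_cat (tolls_within_free _ _) (tolls_within_sub _) => //; apply: mem_drop.
Qed.

Section Crossing.

Variable e : Arc I.
Hypothesis ep : e \in p.

(* Along a walk avoiding e, keep the last visited vertex of p that is not after e; the arcs
   from there to the next vertex of p cannot be toll arcs, as those lie on p. *)
Lemma crossing q w x y i : (i <= index e p)%N ->
    is_walk u (vtx u p i) x -> is_walk (vtx u p i) y w -> free w ->
    is_walk y v q -> tolls_within p q -> e \notin q ->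
  exists i' j x' w' z', [/\ (i' <= index e p < j)%N, (j <= size p)%N,
     x ++ w ++ q = x' ++ w' ++ z',
     is_walk u (vtx u p i') x' /\ is_walk (vtx u p j) v z'
   & is_walk (vtx u p i') (vtx u p j) w' /\ free w'].
Proof.
have ep' : (index e p < size p)%N by rewrite index_mem.
(* Invariant: x ends at the last visited vertex i of p not after e, w is the free stretch walked
   since, and q is still to come. *)
elim: q w x y i => [|a q IH] w x y i il wx ww fw.
  move=> /eqP yv _ _; exists i, (size p), x, w, [::].
  by rewrite il ep' leqnn (vtx_size wp) /= eqxx -yv.
move=> wq okq eq.
have /andP[/eqP sa wq'] := wq.
have okq' : tolls_within p q by move=> b bq; apply: okq; rewrite inE bq orbT.
have eq' : e \notin q by move: eq; rewrite inE negb_or => /andP[].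
case: (boolP (y \in u :: map (@dst I) p)) => [yp|yNp].
  have [r rp yr] : exists2 r, (r <= size p)%N & y = vtx u p r.
    exists (index y (u :: map (@dst I) p)); last by rewrite /vtx nth_index.
    by move: yp; rewrite -index_mem /= size_map ltnS.
  rewrite yr in sa ww wq.
  case: (leqP r (index e p)) => rl; last first.
    by exists i, r, x, w, (a :: q); rewrite il rl rp.
  case: (boolP (toll a)) => ta.
    (* A toll arc leaving vertex r is the arc of p there, and it is not e; the walk is then at
       vertex [r.+1], still not after e. *)
    have ap : a \in p by apply: okq; rewrite ?mem_head.
    have ra : r = index a p.
      apply: (vtx_inj sp) => //; first exact: index_size.
      by rewrite -sa; apply: vtx_src wp ap.
    have rl' : (r < index e p)%N.
      rewrite ltn_neqAle rl andbT; apply/eqP=> rE; move: eq; rewrite inE.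
      suff -> : e = a by rewrite eqxx.
      by rewrite -(nth_index a ep) -rE ra nth_index.
    have da : dst a = vtx u p r.+1 by rewrite ra; apply: vtx_dst.
    have wa : is_walk (vtx u p r) (vtx u p r.+1) [:: a] by rewrite /= sa da !eqxx.
    have [||i' [j [x' [w' [z' [H1 H2 H3 H4 H5]]]]]] :=
       IH [::] (x ++ w ++ [:: a]) (dst a) r.+1 rl' _ _ isT wq' okq' eq'.
    - exact: walk_cat wx (walk_cat ww wa).
    - by rewrite da /=.
    by exists i', j, x', w', z'; split=> //; rewrite -H3 -!catA.
  have [||i' [j [x' [w' [z' [H1 H2 H3 H4 H5]]]]]] :=
     IH [:: a] (x ++ w) (dst a) r rl (walk_cat wx ww) _ _ wq' okq' eq'.
  - by rewrite /= sa !eqxx.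
  - by rewrite /free /= ta.
  by exists i', j, x', w', z'; split=> //; rewrite -H3 -!catA.
have ta : ~~ toll a.
  apply/negP=> ta; case/negP: yNp; rewrite -sa.
  have ap : a \in p by apply: okq; rewrite ?mem_head.
  by rewrite (vtx_src wp ap) /vtx mem_nth //= size_map ltnS index_size.
have [||i' [j [x' [w' [z' [H1 H2 H3 H4 H5]]]]]] :=
   IH (w ++ [:: a]) x (dst a) i il wx _ _ wq' okq' eq'.
- by apply: walk_cat ww _; rewrite /= sa !eqxx.
- rewrite /free all_cat /= ta !andbT; exact: fw.
by exists i', j, x', w', z'; split=> //; rewrite -H3 -!catA.
Qed.

(** Cut q at its crossing of e into x, w, z. Each piece costs at least the part of p it replaces,
    and the totals agree, so w costs exactly as much as its segment. *)
Lemma avoiding_tight T q : toll_shortest T u v p -> is_walk u v q ->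
    tolls_within p q -> e \notin q -> nat_cost T q = nat_cost T p ->
  exists i j, (i <= index e p < j)%N /\ tight T u p i j.
Proof.
move=> shp wq okq eq cq.
have u0 : is_walk u (vtx u p 0) [::] by rewrite /= eqxx.
have [i [j [x [w [z [ij jp qE [wx wz] [ww fw]]]]]]] :=
  @crossing q [::] [::] u 0 (leq0n _) u0 u0 isT wq okq eq.
exists i, j; split=> //; exists w.
have ijp : (i <= j <= size p)%N by clear -ij jp; lia.
have ip : (i <= size p)%N by clear -ijp; lia.
split=> //; have le1 := free_ge shp ijp ww fw.
move: qE cq okq; rewrite /= => -> cq okq.
have [wi wi'] := walk_take_drop ip wp; have [wj wj'] := walk_take_drop jp wp.
have okx := tolls_within_catl okq.
have okz := tolls_within_catr (tolls_within_catr okq).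
have Hx : (nat_cost T (take i p) <= nat_cost T x)%N.
  have := shp _ (walk_cat wx wi').
  rewrite nat_cost_cat (nat_cost_split1 T p i) leq_add2r; apply.
  by apply: tolls_within_cat okx (tolls_within_sub _); apply: mem_drop.
have Hz : (nat_cost T (drop j p) <= nat_cost T z)%N.
  have := shp _ (walk_cat wj wz).
  rewrite nat_cost_cat (nat_cost_split1 T p j) leq_add2l; apply.
  by apply: tolls_within_cat (tolls_within_sub _) okz; apply: mem_take.
have /andP[ij' _] := ijp.
move: cq Hx Hz le1 (nat_cost_split1 T p i) (nat_cost_split1 T p j).
rewrite (nat_cost_split T p ij') !nat_cost_cat (nat_cost_free T fw).
move: (nat_cost T x) (nat_cost T z) (nat_cost T (take i p)) (nat_cost T (drop j p)).
move: (nat_cost T (seg p i j)) (base_cost w) => n1 n2 n3 n4 n5 n6; clear; lia.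
Qed.

End Crossing.

Lemma seg_subseq i r j : (i <= r <= j)%N -> subseq (seg p i r) (seg p i j).
Proof.
case/andP=> ir rj; rewrite /seg (take_seg _ rj) drop_cat.
case: ltnP => [_|]; first exact: prefix_subseq.
by move=> /drop_oversize->; apply: sub0seq.
Qed.

Lemma index_notin_take e k : e \in p -> (k <= index e p)%N -> e \notin take k p.
Proof.
move=> ep ke; apply/negP => /[dup] /index_ltn ek; by rewrite in_take // ltnNge ke.
Qed.

(** * Raising the tolls greedily from the last arc to the first *)

(** Induction on the number l of final arcs already treated. Tolls before the current arc are still
    zero, which gives the last condition for it. *)
Lemma greedy_tolls f0 l : is_walk u v f0 -> free f0 ->
    toll_shortest (fun=> 0%N) u v p ->
  exists T, [/\ toll_shortest T u v p, nat_revenue T (take (size p - l) p) = 0%N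
    & forall e, e \in p -> toll e -> (size p - l <= index e p)%N ->
      exists i j, [/\ (i <= index e p < j)%N, tight T u p i j
                    & nat_revenue T (seg p i (index e p)) = 0%N]].
Proof.
move=> wf0 ff0 sh0; elim: l => [|l [T [shT T0 HT]]].
  exists (fun=> 0%N); split=> //; first exact: nat_revenue0.
  by move=> e; rewrite -index_mem subn0 ltnNge => /negP H _ /H.
case: (leqP (size p) l) => [pl|lp].
  have E : (size p - l.+1 = size p - l)%N by clear -pl; lia.
  by exists T; rewrite E.
set k := (size p - l.+1)%N.
have kp : (k < size p)%N by rewrite /k; clear -lp; lia.
have kS : (size p - l = k.+1)%N by rewrite /k; clear -lp; lia.
rewrite kS in T0 HT.
have [e ep ek] : exists2 e, e \in p & index e p = k.
  have: (0 < size p)%N by clear -lp; lia.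
  case E: p => [//|a0 p'] _; rewrite -E; exists (nth a0 p k); first exact: mem_nth.
  by rewrite index_uniq // (simple_uniq sp).
have T0k : nat_revenue T (take k p) = 0%N.
  apply/eqP; rewrite -leqn0 -T0; apply: nat_revenue_subseq.
  by rewrite (take_seg _ (leqnSn k)) prefix_subseq.
have index_gt f : f \in p -> f != e -> (k <= index f p)%N -> (k < index f p)%N.
  move=> fp fe; rewrite leq_eqVlt => /orP[/eqP kf|//]; case/eqP: fe.
  by rewrite -(nth_index f ep) ek kf nth_index.
case: (boolP (toll e)) => te; last first.
  exists T; split=> // f fp tf kf; apply: HT => //; apply: index_gt => //.
  by apply: contraNneq te => <-.
pose raise c := fun a => (T a + (a == e) * c)%N.
have cost_raise c q : nat_cost (raise c) q = (nat_cost T q + count_mem e q * c)%N.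
  by rewrite /nat_cost nat_revenueD1 // addnA.
have ce : count_mem e p = 1%N by rewrite count_uniq_mem ?ep // (simple_uniq sp).
pose Q c := toll_shortest (raise c) u v p.
have shQ0 : Q 0%N by move=> q wq okq; rewrite !cost_raise !muln0 !addn0; apply: shT.
have T'0 c : nat_revenue (raise c) (take k p) = 0%N.
  rewrite nat_revenueD1 // T0k (count_memPn _) //; apply: index_notin_take => //.
  by rewrite ek.
(* The detour of a later arc f survives the raise: its segment cannot become dearer than w, so it
   either misses e or the raise is zero. *)
have keep c : Q c -> forall f, f \in p -> toll f -> (k.+1 <= index f p)%N ->
   exists i j, [/\ (i <= index f p < j)%N, tight (raise c) u p i j
                 & nat_revenue (raise c) (seg p i (index f p)) = 0%N].
  move=> shc f fp tf kf; have [i [j [ifj [w [ijp ww fw cw]] z]]] := HT f fp tf kf.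
  have := free_ge shc ijp ww fw; rewrite cw cost_raise -{2}(addn0 (nat_cost _ _)).
  rewrite leq_add2l leqn0 => /eqP c0.
  exists i, j; split=> //; first by exists w; split=> //; rewrite cost_raise c0 addn0.
  rewrite nat_revenueD1 // z add0n; apply/eqP; rewrite -leqn0 -c0 leq_mul //.
  by apply: leq_count_subseq; apply: seg_subseq; clear -ifj; lia.
(* The largest admissible raise c exists, since a raise by more than the cost of f0, which avoids e,
   makes f0 cheaper than p. *)
have [c [shc nshc]] : exists c, Q c /\ ~ Q c.+1.
  apply: (@ex_last_holding Q (base_cost f0).+1) => // /(_ f0 wf0 (tolls_within_free _ ff0)).
  rewrite !cost_raise ce (nat_cost_free _ ff0).
  have /count_memPn -> : e \notin f0; last by clear; lia.
  by apply/negP => /(allP ff0); rewrite te.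
exists (raise c); split=> // f fp tf; case: (eqVneq f e) => [->|fe kf]; last first.
  by apply: keep => //; apply: index_gt.
move=> _; suff [q [wq okq eq cq]] : exists q, [/\ is_walk u v q, tolls_within p q,
    e \notin q & nat_cost (raise c) q = nat_cost (raise c) p].
  have [i [j [ij ti]]] := avoiding_tight ep shc wq okq eq cq.
  exists i, j; split=> //; apply/eqP; rewrite -leqn0 -(T'0 c) -ek; apply: nat_revenue_subseq.
  by rewrite /seg; apply: drop_subseq.
apply: NNPP => no; apply: nshc => q wq okq.
have := shc q wq okq; rewrite !cost_raise ce !mul1n => Hc.
case: (posnP (count_mem e q)) => [c0|c_gt]; last by rewrite mulnS; clear -Hc c_gt; lia.
have eq : e \notin q by rewrite -has_pred1 has_count c0.
rewrite leqNgt; apply/negP=> lt; apply: no; exists q; split=> //.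
by rewrite !cost_raise ce; move: lt Hc; rewrite c0; clear; lia.
Qed.

(** * Chaining detours into two walks with disjoint toll arcs *)

Lemma seg_cat i k j : (i <= k <= j)%N -> seg p i j = seg p i k ++ seg p k j.
Proof.
by case/andP=> ik kj; rewrite {1}/seg (drop_seg _ ik) /seg take_takel.
Qed.

Lemma in_drop e i : e \in p -> (e \in drop i p) = (i <= index e p)%N.
Proof.
move=> ep; have := simple_uniq sp; rewrite -{1}(cat_take_drop i p) cat_uniq.
case/and3P=> _ /hasPn dis _; rewrite leqNgt -(in_take _ ep).
have := ep; rewrite -{1}(cat_take_drop i p) mem_cat.
by case: (boolP (e \in drop i p)) => [/dis/negbTE->|_] //; rewrite orbF => ->.
Qed.

Lemma free_or_first_toll b : free (drop b p) \/
  exists e, [/\ e \in p, toll e, (b <= index e p)%N & free (seg p b (index e p))].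
Proof.
case: (boolP (free (drop b p))) => [|/allPn[e0 e0b te0]]; [by left | right].
rewrite negbK in te0; have e0p := mem_drop e0b; rewrite (in_drop _ e0p) in e0b.
pose Q e := [/\ e \in p, toll e & (b <= index e p)%N].
have [e [[ep te be] mine]] := @ex_minimizer _ Q (fun e => index e p) e0 (And3 e0p te0 e0b).
exists e; split=> //; apply/allP => f fs; apply/negP => tf.
have /mem_take fp := mem_drop fs.
have fb : (b <= index f p)%N.
  by rewrite -(in_drop _ fp) (drop_seg p be) mem_cat fs.
have := mine f (And3 fp tf fb); rewrite leqNgt -(in_take _ fp).
by rewrite (mem_drop fs).
Qed.

(* Two walkers: X stands at vertex b, just after a detour, and Y waits at vertex a <= b until
   it takes the detour reaching farthest beyond b; then they exchange roles.  The hypothesis on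
   tight pairs says that X's last detour reached as far as possible, so that Y's next one
   starts at or after a. *)
Lemma two_walks T a b :
    (forall e, e \in p -> toll e -> exists i j, [/\ (i <= index e p < j)%N,
       tight T u p i j & nat_revenue T (seg p i (index e p)) = 0%N]) ->
    (a <= b <= size p)%N ->
    (forall i j, tight T u p i j -> (i < a)%N -> nat_revenue T (seg p i a) = 0%N ->
       (j <= b)%N) ->
  exists X Y, [/\ is_walk (vtx u p b) v X /\ is_walk (vtx u p a) v Y,
    tolls_within (drop b p) X, tolls_within (drop a p) Y,
    forall e, e \in X -> e \in Y -> ~~ toll e
  & (base_cost X + base_cost Y <=
     base_cost (drop a p) + base_cost (drop b p) + nat_revenue T (drop b p))%N].
Proof.
move=> HT; have [n] := ubnP (size p - b); elim: n a b => // n IH a b ltn abp far.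
have bp : (b <= size p)%N by case/andP: abp.
have ap : (a <= size p)%N by clear -abp; lia.
have [_ wa] := walk_take_drop ap wp; have [_ wb] := walk_take_drop bp wp.
case: (free_or_first_toll b) => [fb|[e [ep te be fbe]]].
  exists (drop b p), (drop a p); split=> //; first by move=> e /(allP fb).
  by rewrite addnC leq_addr.
have [i0 [j0 [ij0 tij0 z0]]] := HT e ep te.
(* The endpoints j of the detours available to Y: they start at or before b, with no toll charged
   from there to b. *)
pose Q j := exists i, [/\ (i <= b)%N, tight T u p i j & nat_revenue T (seg p i b) = 0%N].
have Qj0 : Q j0.
  case: (leqP i0 b) => ib.
    exists i0; split=> //; apply/eqP; rewrite -leqn0 -z0; apply: nat_revenue_subseq.
    by apply: seg_subseq; clear -ib be; lia.
  (* A detour starting beyond b is extended back to b along p, where the arcs are free because e is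
     the first toll arc after b. *)
  have [w [ijp ww fw cw]] := tij0.
  have fb0 : free (seg p b i0).
    apply/allP => f fs; apply: (allP fbe); apply: mem_subseq fs.
    by apply: seg_subseq; clear -ib ij0; lia.
  exists b; rewrite leqnn /seg drop_oversize ?size_take; last by case: ltnP => // /ltnW.
  rewrite /nat_revenue big_nil; split=> //; exists (seg p b i0 ++ w); split.
  - by clear -ib ijp; lia.
  - by apply: walk_cat ww; apply: walk_seg wp; clear -ib ijp; lia.
  - by rewrite /free all_cat; apply/andP.
  rewrite base_cost_cat cw -(nat_cost_free T fb0) -nat_cost_cat -seg_cat //; clear -ib ijp; lia.
have j0p : (j0 <= size p)%N by case: tij0 => w [/andP[]].
have [j [j0j [i [ib [w [ijp ww fw cw]] z]] maxj]] := ex_greatest j0p Qj0.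
(* Were i < a, [far] would give j <= b, although j >= j0 and j0 lies beyond e. *)
have ai : (a <= i)%N.
  rewrite leqNgt; apply/negP => ia.
  suff: (j <= b)%N by clear -j0j ij0 be; lia.
  apply: (far i) => //; first by exists w.
  by apply/eqP; rewrite -leqn0 -z; apply: nat_revenue_subseq; apply: seg_subseq; clear -ia abp; lia.
have [|||X [Y [[wX wY] tX tY dis c]]] := IH b j.
- by clear -ltn j0j ij0 be ijp; lia.
- by clear -j0j ij0 be ijp; lia.
- move=> i' j' t' ib' z'; apply: maxj; first by case: t' => ? [/andP[]].
  by exists i'; rewrite ltnW.
(* The induction hypothesis let Y wait at b and X continue from j, so the names are exchanged
   here. *)
exists Y, (seg p a i ++ w ++ X); split.
- by split=> //; apply: walk_cat (walk_cat ww wX); apply: walk_seg wp; clear -ai ijp; lia.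
- by [].
- apply: tolls_within_cat; last apply: tolls_within_cat; first 1 last.
  + exact: tolls_within_free.
  + move=> f fX tf; have := tX f fX tf.
    rewrite (drop_seg p (i := a) (j := j)); last by clear -ai ijp; lia.
    by rewrite mem_cat orbC => ->.
  + by move=> f fs _; rewrite (drop_seg p ai) mem_cat fs.
- move=> f fY; rewrite !mem_cat => /or3P[fs|/(allP fw)//|fX]; last exact: dis.
  apply/negP => tf; have fb := tY f fY tf; have fp := mem_drop fb.
  move: fb; rewrite (in_drop _ fp) leqNgt -(in_take _ fp) => /negP; apply.
  by rewrite (take_seg p ib) mem_cat (mem_drop fs).
(* The detour w costs the fixed costs and tolls of its segment. Its tolls before b are zero, so
   those between b and j pay for it, and those after j are left for the rest of the chain. *)
move: c cw; have bj : (b <= j)%N by clear -j0j ij0 be; lia.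
rewrite !base_cost_cat /nat_cost.
rewrite (@drop_seg p a i) // (@drop_seg p i j); last by clear -ijp; lia.
rewrite (@drop_seg p b j) //.
rewrite !base_cost_cat !nat_revenue_cat (@seg_cat i b j) ?ib //.
rewrite base_cost_cat nat_revenue_cat z; clear; lia.
Qed.

End OnePath.

Lemma count_disjoint p x y : uniq p -> uniq x -> uniq y ->
    tolls_within p x -> tolls_within p y ->
    (forall e, e \in x -> e \in y -> ~~ toll e) ->
  (count (@toll I) x + count (@toll I) y <= count (@toll I) p)%N.
Proof.
move=> up ux uy tx ty dis; rewrite -!size_filter -size_cat; apply: uniq_leq_size.
  rewrite cat_uniq !filter_uniq //= andbT; apply/hasPn => e.
  rewrite !mem_filter => /andP[te ey]; rewrite te /=; apply/negP => ex.
  by have := dis e ex ey; rewrite te.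
move=> e; rewrite mem_cat !mem_filter -andb_orr => /andP[te].
by rewrite te /= => /orP[/tx|/ty]; apply.
Qed.

(* This is 2 LP(p) <= Rev(p) + LP(x) + LP(y). *)
Lemma split_path u v p f0 : is_walk u v p -> simple u p -> is_walk u v f0 -> free f0 ->
    toll_shortest (fun=> 0%N) u v p ->
  exists T x y, [/\ toll_shortest T u v p,
    [/\ is_walk u v x, simple u x & tolls_within p x],
    [/\ is_walk u v y, simple u y & tolls_within p y],
    (count (@toll I) x + count (@toll I) y <= count (@toll I) p)%N
  & (base_cost x + base_cost y <= base_cost p + base_cost p + nat_revenue T p)%N].
Proof.
move=> wp sp wf0 ff0 sh0.
have [T [shT _ HT]] := greedy_tolls wp sp (size p) wf0 ff0 sh0.
have {}HT e : e \in p -> toll e -> exists i j, [/\ (i <= index e p < j)%N,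
       tight T u p i j & nat_revenue T (seg p i (index e p)) = 0%N].
  by move=> ep te; apply: HT; rewrite // subnn.
(* Both walkers start at vertex 0, where the condition on tight pairs is vacuous. *)
have [|X [Y [[wX wY] tX tY dis c]]] := @two_walks u v p wp sp T 0 0 HT isT.
  by move=> i j _.
rewrite !drop0 in tX tY c.
have [x [wx sx xX]] := walk_simplify wX; have [y [wy sy yY]] := walk_simplify wY.
have tx : tolls_within p x by move=> e /(mem_subseq xX); apply: tX.
have ty : tolls_within p y by move=> e /(mem_subseq yY); apply: tY.
exists T, x, y; split=> //.
  apply: count_disjoint => //; try exact: simple_uniq; try exact: simple_uniq sp.
  - exact: simple_uniq sx.
  - exact: simple_uniq sy.
  - by move=> e /(mem_subseq xX) eX /(mem_subseq yY); apply: dis.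
move: (base_cost_subseq xX) (base_cost_subseq yY) c; clear; lia.
Qed.

(** * The upper bound by recursion on the number of toll arcs *)

Lemma count_tolls_within p q : uniq q -> tolls_within p q ->
  (count (@toll I) q <= count (@toll I) p)%N.
Proof.
move=> uq tq; rewrite -!size_filter; apply: uniq_leq_size; first exact: filter_uniq.
by move=> e; rewrite !mem_filter => /andP[te eq]; rewrite te /= tq.
Qed.

Lemma count_toll0 p : count (@toll I) p = 0%N -> free p.
Proof.
by move=> c0; have := all_predC (@toll I) p; rewrite has_count c0 => H; exact: H.
Qed.

(** Strong induction on k through [split_path]: when both x and y carry toll arcs, each has fewer
    than k of them and together at most k, so [alpha_ge] applies. *)
Lemma gap_bound u v f0 (L : nat) (B : R) : is_walk u v f0 -> free f0 ->
    (forall q, is_walk u v q -> simple u q -> free q -> (L <= base_cost q)%N) ->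
    (forall T p, is_walk u v p -> simple u p -> toll_shortest T u v p ->
       (INR (nat_revenue T p) <= B)%R) ->
  forall k p, is_walk u v p -> simple u p -> (count (@toll I) p <= k)%N -> (0 < k)%N ->
    (INR L - INR (base_cost p) <= alpha k * B)%R.
Proof.
move=> wf0 ff0 HL HB k; have [n] := ubnP k; elim: n k => // n IH k kn p wp sp cp k0.
pose Q q := [/\ is_walk u v q, simple u q & tolls_within p q].
have Qp : Q p by split.
(* By [walk_simplify], the cheapest simple path on the toll arcs of p is also cheapest among walks,
   as [split_path] requires. *)
have [p' [[wp' sp' tp'] minp']] := @ex_minimizer _ Q base_cost p Qp.
have sh' : toll_shortest (fun=> 0%N) u v p'.
  move=> q wq okq; rewrite /nat_cost !nat_revenue0 !addn0.
  have [q' [wq' sq' sub]] := walk_simplify wq.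
  apply: leq_trans (base_cost_subseq sub); apply: minp'; split=> //.
  by move=> e /(mem_subseq sub) eq te; exact: tp' (okq e eq te) te.
have [T [x [y [shT [wx sx tx] [wy sy ty] cxy bxy]]]] := split_path wp' sp' wf0 ff0 sh'.
have HR := HB T p' wp' sp' shT.
have R0 : (0 <= INR (nat_revenue T p'))%R by apply: pos_INR.
have cp' : (count (@toll I) p' <= k)%N.
  by apply: leq_trans cp; apply: count_tolls_within tp'; apply: simple_uniq sp'.
have tt q : tolls_within p' q -> tolls_within p q by move=> H e eq te; exact: tp' (H e eq te) te.
have Hx : (base_cost p' <= base_cost x)%N by apply: minp'; split=> //; apply: tt.
have Hy : (base_cost p' <= base_cost y)%N by apply: minp'; split=> //; apply: tt.
have Hp : (base_cost p' <= base_cost p)%N by apply: minp'.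
have le_R := fun a b (h : (a <= b)%N) => le_INR a b (elimT leP h).
have Hp_R := le_R _ _ Hp; have bxy_R := le_R _ _ bxy.
have Hx_R := le_R _ _ Hx; have Hy_R := le_R _ _ Hy.
rewrite !plus_INR in bxy_R.
have a1 := alpha_ge1 k0.
have HaB : (B <= alpha k * B)%R.
  by have : (0 <= (alpha k - 1) * B)%R; [apply: Rmult_le_pos; lra | lra].
(* If x is free it costs at least L, while y costs at least as much as p', so the gap of p' is at
   most its revenue. *)
case: (posnP (count (@toll I) x)) => [/count_toll0 fx|cx].
  have := le_R _ _ (HL x wx sx fx); lra.
case: (posnP (count (@toll I) y)) => [/count_toll0 fy|cy].
  have := le_R _ _ (HL y wy sy fy); lra.
have IHx : (INR L - INR (base_cost x) <= alpha (count (@toll I) x) * B)%R.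
  by apply: IH => //; clear -kn cxy cp' cy; lia.
have IHy : (INR L - INR (base_cost y) <= alpha (count (@toll I) y) * B)%R.
  by apply: IH => //; clear -kn cxy cp' cx; lia.
have /(Rmult_le_compat_r B _ _ _) := alpha_ge cx cy (leq_trans cxy cp').
move=> /(_ (Rle_trans _ _ _ R0 HR)); lra.
Qed.

(** * From natural tolls to real ones *)

Lemma sumR_INR (X : Type) (f : X -> nat) (s : seq X) :
  sumR [seq INR (f x) | x <- s] = INR (\sum_(x <- s) f x).
Proof.
by elim: s => [|x s IH]; rewrite ?big_nil // big_cons plus_INR /= IH.
Qed.

Lemma path_cost_INR T p : path_cost (fun a => INR (T a)) p = INR (nat_cost T p).
Proof.
rewrite /nat_cost /base_cost /nat_revenue [X in (_ + X)%N]big_mkcond -big_split /= -sumR_INR.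
congr sumR; apply: eq_map => a; rewrite /arc_cost.
by case: ifP => _; rewrite plus_INR //= Rplus_0_r.
Qed.

Lemma revenue_INR T p : revenue (fun a => INR (T a)) p = INR (nat_revenue T p).
Proof. by rewrite /revenue sumR_INR big_filter. Qed.

Lemma path_cost_zero p : path_cost (@zero_tolls I) p = INR (base_cost p).
Proof.
by rewrite (path_cost_INR (fun=> 0%N)) /nat_cost nat_revenue0 addn0.
Qed.

(* The arcs off p get the toll [nat_cost T p], which no path cheaper than p can afford. *)
Lemma feasible_nat T p : st_path p -> toll_shortest T (s_of I) (t_of I) p ->
  exists T0 : Arc I -> R, feasible T0 p /\ revenue T0 p = INR (nat_revenue T p).
Proof.
move=> stp shp; pose S a := if a \in p then T a else nat_cost T p.
have revS q : tolls_within p q -> nat_revenue S q = nat_revenue T q.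
  move=> okq; rewrite /nat_revenue big_seq_cond [RHS]big_seq_cond.
  by apply: eq_bigr => a /andP[aq ta]; rewrite /S okq.
have revp := revS p (tolls_within_sub (fun _ => id)).
exists (fun a => INR (S a)); split; last by rewrite revenue_INR revp.
split; first by move=> a _; apply: pos_INR.
split=> // q /andP[wq _]; rewrite !path_cost_INR; apply/le_INR/leP.
rewrite {1}/nat_cost revp.
case: (classic (tolls_within p q)) => [okq|nok].
  by rewrite /(nat_cost S) revS //; apply: shp.
have [a aq /andP[ta ap]] : exists2 a, a \in q & toll a && (a \notin p).
  apply: NNPP => no; apply: nok => a aq ta; apply: NNPP => ap.
  by apply: no; exists a; rewrite // ta; apply/negP.
apply: leq_trans (leq_addl _ _).
case/splitPr: aq => q1 q2; rewrite nat_revenue_cat.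
have -> : nat_revenue S (a :: q2) = (nat_cost T p + nat_revenue S q2)%N.
  by rewrite {1}/nat_revenue big_cons ta {1}/S (negbTE ap).
by rewrite addnCA leq_addr.
Qed.

End Walks.

Lemma count_toll_le_mT (I : instance) (p : seq (Arc I)) : uniq p ->
  (count (@toll I) p <= mT I)%N.
Proof.
move=> up; rewrite -size_filter /mT cardE; apply: uniq_leq_size.
  exact: filter_uniq.
by move=> e; rewrite mem_filter mem_enum => /andP[].
Qed.

(** B is kept arbitrary to serve twice: as the optimum in the upper bound, and as one less than the
    intended optimum when proving that the latter is attained. *)
Lemma instance_gap (I : instance) (Linf L0 B : R) : (0 < mT I)%N ->
    is_Linf I Linf -> is_L0 I L0 ->
    (forall T p, @st_path I p -> toll_shortest T (s_of I) (t_of I) p ->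
       (INR (nat_revenue T p) <= B)%R) ->
  (Linf - L0 <= alpha (mT I) * B)%R.
Proof.
move=> m0 [[f [tf <-]] minf] [[p [sp <-]] minp] HB.
have [/andP[wf sf] ff] := andP tf; have [wp up] := andP sp.
rewrite !path_cost_zero; apply: (gap_bound wf ff) => //.
- move=> q wq sq fq; apply/leP/INR_le; rewrite -!path_cost_zero; apply: minf.
  by rewrite /toll_free_path /st_path wq; apply/andP.
- by move=> T q wq sq; apply: HB; rewrite /st_path wq.
- by apply: count_toll_le_mT; apply: simple_uniq up.
Qed.

(** * Series composition with two toll-free detours *)

Lemma sumR_cat (s1 s2 : seq R) : sumR (s1 ++ s2) = (sumR s1 + sumR s2)%R.
Proof. by elim: s1 => [|a s1 IH] /=; rewrite ?IH; lra. Qed.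

Lemma path_cost_cat (I : instance) (T : Arc I -> R) p q :
  path_cost T (p ++ q) = (path_cost T p + path_cost T q)%R.
Proof. by rewrite /path_cost map_cat sumR_cat. Qed.

Lemma revenue_cat (I : instance) (T : Arc I -> R) p q :
  revenue T (p ++ q) = (revenue T p + revenue T q)%R.
Proof. by rewrite /revenue filter_cat map_cat sumR_cat. Qed.

Lemma revenue_le_cost (I : instance) (T : Arc I -> R) p :
  (revenue T p <= path_cost T p)%R.
Proof.
elim: p => [|a p IH]; first exact: Rle_refl.
have c0 := pos_INR (cost a); rewrite /revenue /path_cost /= /arc_cost.
by case: ifP => _ /=; move: IH; rewrite /revenue /path_cost /arc_cost; lra.
Qed.

Lemma simple_loop (I : instance) (u : V I) p : is_walk u u p -> simple u p -> p = [::].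
Proof.
move=> wp sp; apply: size0nil; apply: (vtx_inj sp) => //.
by rewrite (vtx_size wp).
Qed.

Section Series.

Variables (I1 I2 : instance) (x y : nat).

(* I1 followed by I2 (arc None, of cost 0), with a toll-free detour of cost x around I1
   (arc Some false) and one of cost y around I2 (arc Some true). *)
Definition series : instance :=
  @Instance (V I1 + V I2)%type ((Arc I1 + Arc I2) + option bool)%type
    (fun a => match a with
      | inl (inl a1) => inl (src a1)
      | inl (inr a2) => inr (src a2)
      | inr (Some false) => inl (s_of I1)
      | inr _ => inl (t_of I1) end)
    (fun a => match a with
      | inl (inl a1) => inl (dst a1)
      | inl (inr a2) => inr (dst a2)
      | inr (Some true) => inr (t_of I2)
      | inr _ => inr (s_of I2) end)
    (fun a => match a with
      | inl (inl a1) => toll a1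
      | inl (inr a2) => toll a2
      | inr _ => false end)
    (fun a => match a with
      | inl (inl a1) => cost a1
      | inl (inr a2) => cost a2
      | inr None => 0
      | inr (Some false) => x
      | inr (Some true) => y end)%N
    (inl (s_of I1)) (inr (t_of I2)).

Definition arcl (a : Arc I1) : Arc series := inl (inl a).
Definition arcr (a : Arc I2) : Arc series := inl (inr a).
Definition link (b : option bool) : Arc series := inr b.

Lemma walk_arcl u v p : @is_walk series (inl u) (inl v) (map arcl p) = is_walk u v p.
Proof. by elim: p u => [|a p IH] u //=; rewrite IH. Qed.

Lemma walk_arcr u v p : @is_walk series (inr u) (inr v) (map arcr p) = is_walk u v p.
Proof. by elim: p u => [|a p IH] u //=; rewrite IH. Qed.

Lemma walk_from_right u v p : @is_walk series (inr u) (inr v) p ->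
  exists2 p2, p = map arcr p2 & is_walk u v p2.
Proof.
elim: p u => [|[[a|a]|[[]|]] p IH] u //=; first by exists [::].
by case/andP=> /eqP[sa] /IH[p2 -> w2]; exists (a :: p2) => //=; rewrite sa eqxx.
Qed.

(** Only the arcs [link b] lead from I1 to I2 and none leads back, so exactly one is used; b
    determines where I1 is left and I2 entered. *)
Lemma walk_from_left u v p : @is_walk series (inl u) (inr v) p ->
  exists p1 b p2, p = map arcl p1 ++ link b :: map arcr p2 /\
    is_walk u (if b == Some false then s_of I1 else t_of I1) p1 /\
    is_walk (if b == Some true then t_of I2 else s_of I2) v p2.
Proof.
elim: p u => [|[[a|a]|b] p IH] u //=.
  case/andP=> /eqP[sa] /IH[p1 [b [p2 [-> [w1 w2]]]]].
  by exists (a :: p1), b, p2; rewrite /= sa eqxx.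
case/andP=> ub wp; exists [::], b.
have [|p2 -> w2] := @walk_from_right (if b == Some true then t_of I2 else s_of I2) v p.
  by case: b wp {ub} => [[]|].
by exists p2; split=> //; split=> //; case: b ub {wp w2} => [[]|] /eqP[<-] /=.
Qed.

Lemma map_dst_arcl p : map (@dst series) (map arcl p) = map inl (map (@dst I1) p).
Proof. by rewrite -!map_comp; apply: eq_map. Qed.

Lemma map_dst_arcr p : map (@dst series) (map arcr p) = map inr (map (@dst I2) p).
Proof. by rewrite -!map_comp; apply: eq_map. Qed.

Lemma simple_series u p1 b p2 :
  @simple series (inl u) (map arcl p1 ++ link b :: map arcr p2) =
  simple u p1 && simple (if b == Some true then t_of I2 else s_of I2) p2.
Proof.
set c := if _ then _ else _.
have E1 : inl u :: map (@dst series) (map arcl p1) = map inl (u :: map (@dst I1) p1).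
  by rewrite map_dst_arcl.
have E2 : map (@dst series) (link b :: map arcr p2) = map inr (c :: map (@dst I2) p2).
  by rewrite /= map_dst_arcr /c; case: (b) => [[]|].
rewrite /simple map_cat -cat_cons E1 E2 cat_uniq !map_inj_uniq; try by move=> ? ? [].
congr andb; rewrite -[RHS]andTb; congr andb.
by apply/hasPn => w /mapP[w2 _ ->]; apply/mapP => -[].
Qed.

Lemma st_path_through p1 p2 : st_path p1 -> st_path p2 ->
  st_path (map arcl p1 ++ link None :: map arcr p2).
Proof.
case/andP=> w1 u1 /andP[w2 u2]; apply/andP; split.
  apply: (@walk_cat series _ (inl (t_of I1))); first by rewrite walk_arcl.
  by rewrite /= eqxx walk_arcr.
by have := simple_series (s_of I1) p1 None p2; rewrite /simple u1 u2 => ->.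
Qed.

Lemma st_path_right p2 : st_path p2 -> st_path (link (Some false) :: map arcr p2).
Proof.
case/andP=> w2 u2; apply/andP; split; first by rewrite /= eqxx walk_arcr.
by have := simple_series (s_of I1) [::] (Some false) p2; rewrite /simple u2 => ->.
Qed.

Lemma st_path_left p1 : st_path p1 -> st_path (map arcl p1 ++ [:: link (Some true)]).
Proof.
case/andP=> w1 u1; apply/andP; split.
  apply: (@walk_cat series _ (inl (t_of I1))); first by rewrite walk_arcl.
  by rewrite /= !eqxx.
by have := simple_series (s_of I1) p1 (Some true) [::]; rewrite /simple u1 => ->.
Qed.

(** With a detour, the walk left in the bypassed part is simple and closed, hence empty. *)
Lemma st_path_series p : @st_path series p ->
  [\/ exists p1 p2, [/\ p = map arcl p1 ++ link None :: map arcr p2, st_path p1 & st_path p2],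
      exists2 p2, p = link (Some false) :: map arcr p2 & st_path p2
    | exists2 p1, p = map arcl p1 ++ [:: link (Some true)] & st_path p1].
Proof.
case/andP=> /walk_from_left[p1 [b [p2 [-> [w1 w2]]]]].
rewrite -/(@simple series _ _) simple_series => /andP[s1 s2].
case: b w1 w2 s2 => [[]|] /= w1 w2 s2.
- constructor 3; exists p1; last by apply/andP.
  by rewrite (simple_loop w2 s2).
- constructor 2; exists p2; last by apply/andP.
  by rewrite (simple_loop w1 s1).
- by constructor 1; exists p1, p2; split=> //; apply/andP.
Qed.

Lemma path_cost_arcl T p : path_cost T (map arcl p) = path_cost (T \o arcl) p.
Proof. by rewrite /path_cost -map_comp. Qed.

Lemma path_cost_arcr T p : path_cost T (map arcr p) = path_cost (T \o arcr) p.
Proof. by rewrite /path_cost -map_comp. Qed.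

Lemma revenue_arcl T p : revenue T (map arcl p) = revenue (T \o arcl) p.
Proof. by rewrite /revenue filter_map -map_comp. Qed.

Lemma revenue_arcr T p : revenue T (map arcr p) = revenue (T \o arcr) p.
Proof. by rewrite /revenue filter_map -map_comp. Qed.

Lemma path_cost_link T b p : path_cost T (link b :: p) = (INR (cost (link b)) + path_cost T p)%R.
Proof. by []. Qed.

Lemma revenue_link T b p : revenue T (link b :: p) = revenue T p.
Proof. by []. Qed.

Lemma base_cost_arcl p : base_cost (map arcl p) = base_cost p.
Proof. by rewrite /base_cost big_map. Qed.

Lemma base_cost_arcr p : base_cost (map arcr p) = base_cost p.
Proof. by rewrite /base_cost big_map. Qed.

Lemma base_cost_link b p : base_cost (link b :: p) = (cost (link b) + base_cost p)%N.
Proof. by rewrite /base_cost big_cons. Qed.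

Lemma mT_series : mT series = (mT I1 + mT I2)%N.
Proof.
have E (J : instance) : mT J = (\sum_(a : Arc J) toll a)%N.
  by rewrite /mT -sum1_card big_mkcond.
by rewrite !E !big_sumType /= [X in (_ + X)%N]big1 ?addn0 // => -[].
Qed.

End Series.

Arguments arcl {I1 I2 x y} a.
Arguments arcr {I1 I2 x y} a.
Arguments link {I1 I2 x y} b.
Arguments st_path_through {I1 I2} x y {p1 p2}.
Arguments st_path_left {I1 I2} x y {p1}.
Arguments st_path_right {I1 I2} x y {p2}.

(** * Tight instances *)

(** Only OPT <= N is recorded: once A = N alpha(k), the general upper bound forces equality. *)
Record gadget (I : instance) (N A k : nat) : Prop := Gadget {
  gadget_mT : mT I = k;
  gadget_L0 : exists2 p, @st_path I p & base_cost p = 0%N;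
  gadget_Linf : exists2 p, @toll_free_path I p & base_cost p = A;
  gadget_Linf_min : forall p, @toll_free_path I p -> (A <= base_cost p)%N;
  gadget_revenue : forall T p, @feasible I T p -> (revenue T p <= INR N)%R }.

(** The two equations make the cheapest free path through either detour cost A, and A <= A1 + A2
    keeps the free paths through both parts from being cheaper. *)
Lemma series_gadget I1 I2 x y N A1 A2 A k1 k2 :
  gadget I1 N A1 k1 -> gadget I2 N A2 k2 ->
  (x + A2 = A)%N -> (A1 + y = A)%N -> (x + y = N)%N -> (A <= A1 + A2)%N ->
  gadget (series I1 I2 x y) N A (k1 + k2).
Proof.
case=> m1 [p1 s1 c1] [f1 /andP[sf1 ff1] cf1] min1 rev1.
case=> m2 [p2 s2 c2] [f2 /andP[sf2 ff2] cf2] min2 rev2 xA yA xyN leA.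
split.
- by rewrite mT_series m1 m2.
- exists (map (@arcl I1 I2 x y) p1 ++ @link I1 I2 x y None :: map (@arcr I1 I2 x y) p2).
    exact: st_path_through.
  by rewrite base_cost_cat base_cost_link base_cost_arcl base_cost_arcr c1 c2.
- exists (@link I1 I2 x y (Some false) :: map (@arcr I1 I2 x y) f2).
    by rewrite /toll_free_path st_path_right //= all_map.
  by rewrite base_cost_link base_cost_arcr cf2.
- move=> p /andP[/st_path_series[[q1 [q2 [-> w1 w2]]]|[q2 -> w2]|[q1 -> w1]]].
  + rewrite all_cat /= !all_map => /andP[g1 g2].
    rewrite base_cost_cat base_cost_link base_cost_arcl base_cost_arcr /=.
    apply: leq_trans leA _; rewrite add0n; apply: leq_add.
      by apply: min1; apply/andP.
    by apply: min2; apply/andP.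
  + rewrite /= all_map => g2; rewrite base_cost_link base_cost_arcr -xA leq_add2l.
    by apply: min2; apply/andP.
  + rewrite all_cat all_map => /andP[g1 _].
    rewrite base_cost_cat base_cost_link base_cost_arcl -yA; apply: leq_add.
      by apply: min1; apply/andP.
    exact: leq_addr.
move=> T p [T0 [/st_path_series[[q1 [q2 [-> w1 w2]]]|[q2 -> w2]|[q1 -> w1]] sh]].
(* Compared with the two detours, q1 costs at most x and q2 at most y, tolls included; the revenue
   is at most x + y. *)
- have := sh _ (st_path_right x y w2); have := sh _ (st_path_left x y w1).
  rewrite !path_cost_cat !path_cost_link path_cost_arcl path_cost_arcr.
  have -> : INR (cost (@link I1 I2 x y None)) = 0%R by [].
  have -> : cost (@link I1 I2 x y (Some false)) = x by [].
  have -> : cost (@link I1 I2 x y (Some true)) = y by [].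
  have -> : path_cost T [::] = 0%R by [].
  rewrite revenue_cat revenue_link revenue_arcl revenue_arcr -xyN plus_INR.
  have := revenue_le_cost (T \o @arcl I1 I2 x y) q1.
  have := revenue_le_cost (T \o @arcr I1 I2 x y) q2; lra.
(* The fixed cost of the detour cancels, so q2 is shortest in I2 under the restricted tolls. *)
- rewrite revenue_link revenue_arcr; apply: rev2; split; first by move=> a; apply: (T0 (arcr a)).
  split=> // q wq; have := sh _ (st_path_right x y wq).
  by rewrite !path_cost_link !path_cost_arcr => /Rplus_le_reg_l.
- rewrite revenue_cat revenue_link revenue_arcl /revenue /= Rplus_0_r.
  apply: rev1; split; first by move=> a; apply: (T0 (arcl a)).
  split=> // q wq; have := sh _ (st_path_left x y wq).
  by rewrite !path_cost_cat !path_cost_arcl => /Rplus_le_reg_r.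
Qed.

Definition two_arcs (N : nat) : instance :=
  @Instance bool bool (fun=> false) (fun=> true) id (fun a => if a then 0%N else N)
    false true.

Lemma st_path_two_arcs N p : @st_path (two_arcs N) p -> exists a, p = [:: a].
Proof.
by case/andP; case: p => [|a [|b p]] //= _ _; exists a.
Qed.

Lemma two_arcs_gadget N : gadget (two_arcs N) N N 1.
Proof.
have st (a : bool) : @st_path (two_arcs N) [:: a] by [].
have bc (a : bool) : @base_cost (two_arcs N) [:: a] = if a then 0%N else N.
  by rewrite /base_cost big_cons big_nil addn0.
split.
- by rewrite /mT -(card1 true); apply: eq_card => -[].
- by exists [:: true]; [exact: (st true) | exact: (bc true)].
- by exists [:: false]; [rewrite /toll_free_path (st false) | exact: (bc false)].
- by move=> p /andP[/st_path_two_arcs[[] ->]] //= _; rewrite bc.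
- move=> T p [T0 [/st_path_two_arcs[[] ->] sh]]; last first.
    exact: (pos_INR N).
  by have := sh _ (st false); rewrite /path_cost /revenue /arc_cost /=; lra.
Qed.

Lemma INR_mul a b : INR (a * b)%N = (INR a * INR b)%R.
Proof. exact: mult_INR. Qed.

Lemma INR_exp2 n : INR (2 ^ n)%N = (2 ^ n)%R.
Proof. by elim: n => // n IH; rewrite expnS INR_mul IH. Qed.

(* The costs are scaled so that the optimal value is 2^n: 2^(k-1) * alpha k is an integer. *)
Lemma gadget_exists k : (0 < k)%N ->
  exists b : nat, INR b = (2 ^ k.-1 * alpha k)%R /\
    forall n, (k <= n.+1)%N -> exists I, gadget I (2 ^ n) (2 ^ (n.+1 - k) * b) k.
Proof.
have [m] := ubnP k; elim: m k => // m IH k km k0.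
case: (ltnP 1 k) => [k1|k1]; last first.
  have -> : k = 1%N by clear -k0 k1; lia.
  exists 1%N; split; first by rewrite alpha1 /=; lra.
  by move=> n _; exists (two_arcs (2 ^ n)); rewrite subn1 muln1; apply: two_arcs_gadget.
have [i [j [i0 ij ijk ak]]] := alpha_split k1.
have j0 : (0 < j)%N by apply: leq_trans ij.
have [bi [Ei Hi]] : _ := IH i (ltac:(clear -km ijk j0; lia)) i0.
have [bj [Ej Hj]] : _ := IH j (ltac:(clear -km ijk i0; lia)) j0.
have aj_ak : (alpha j <= alpha k)%R by apply: alpha_le j0 _; clear -ijk; lia.
have ai_aj : (alpha i <= alpha j)%R by apply: alpha_le.
have ai1 := alpha_ge1 i0.
have scale n l b : (0 < l)%N -> (l <= n.+1)%N -> INR b = (2 ^ l.-1 * alpha l)%R ->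
    INR (2 ^ (n.+1 - l) * b) = (2 ^ n * alpha l)%R.
  move=> l0 ln Eb; rewrite INR_mul INR_exp2 Eb -Rmult_assoc -pow_add; congr (_ ^ _ * _)%R.
  by clear -l0 ln; lia.
(* The three terms are 2^(k-2) times 1, alpha(i) and alpha(j), as 2^(i-1) alpha(i) = bi and likewise
   for j. *)
pose b := (2 ^ (k - 2) + 2 ^ (k.-1 - i) * bi + 2 ^ (k.-1 - j) * bj)%N.
have kE : k.-1 = (k - 2).+1 by clear -k1; lia.
have Eb : INR b = (2 ^ k.-1 * alpha k)%R.
  rewrite /b kE !plus_INR !scale ?INR_exp2 //; try by clear -kE ijk i0 j0; lia.
  by rewrite -tech_pow_Rmult; nra.
exists b; split=> // n kn; have n0 : (0 < n)%N by clear -kn k1; lia.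
have nE : n = n.-1.+1 by rewrite prednK.
have [I1 G1] := Hi n (ltac:(clear -ijk kn; lia)).
have [I2 G2] := Hj n (ltac:(clear -ijk kn; lia)).
have S l c : (l <= n)%N -> (2 ^ (n.+1 - l) * c = 2 * (2 ^ (n.-1.+1 - l) * c))%N.
  by move=> ln; rewrite -nE subSn // expnS mulnA.
(* In these units the parts have toll-free lengths 2P and 2q, the composition has h + P + q, and N =
   2h; this dictates the detour costs h + P - q and h + q - P. *)
pose h := (2 ^ n.-1)%N; pose P := (2 ^ (n.-1.+1 - i) * bi)%N; pose q := (2 ^ (n.-1.+1 - j) * bj)%N.
have hR : INR h = (2 ^ n.-1)%R by rewrite INR_exp2.
have h0 : (0 < 2 ^ n.-1)%R by apply: pow_lt; lra.
have PR : INR P = (2 ^ n.-1 * alpha i)%R by apply: scale => //; clear -ijk kn j0 n0; lia.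
have qR : INR q = (2 ^ n.-1 * alpha j)%R by apply: scale => //; clear -ijk kn i0 n0; lia.
have Ah : (2 ^ (n.+1 - k) * b = h + P + q)%N.
  apply: INR_eq; rewrite scale // {1}nE -tech_pow_Rmult !plus_INR hR PR qR; nra.
have N2 : (2 ^ n = 2 * h)%N by rewrite {1}nE expnS.
rewrite S in G1; last by clear -ijk kn j0; lia.
rewrite S in G2; last by clear -ijk kn i0; lia.
(* The subtractions do not truncate: alpha(j) <= alpha(k) gives alpha(j) <= 1 + alpha(i). *)
have qhP : (q <= h + P)%N.
  by apply/leP/INR_le; rewrite plus_INR hR PR qR; nra.
have Phq : (P <= h + q)%N.
  by apply/leP/INR_le; rewrite plus_INR hR PR qR; nra.
have hPq : (h <= P + q)%N.
  by apply/leP/INR_le; rewrite plus_INR hR PR qR; nra.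
exists (series I1 I2 (h + P - q) (h + q - P)).
rewrite -{2}ijk Ah N2; rewrite N2 in G1 G2.
by apply: series_gadget G1 G2 _ _ _ _; rewrite -/P -/q; clear -qhP Phq hPq; lia.
Qed.

(** * The ratio bound and its attainment *)

Local Open Scope R_scope.

Theorem theorem7 (m : nat) (hm : (1 <= m)%N) :
  (forall (I : instance) (Linf L0 opt : R),
      valid_instance I -> mT I = m ->
      is_Linf I Linf -> is_L0 I L0 -> is_OPT I opt -> (0 < opt) ->
      ((Linf - L0) / opt <= alpha m)) /\
  (exists (I : instance) (Linf L0 opt : R),
      valid_instance I /\ mT I = m /\
      is_Linf I Linf /\ is_L0 I L0 /\ is_OPT I opt /\ (0 < opt) /\
      ((Linf - L0) / opt = alpha m)).
Proof.
split=> [I Linf L0 opt _ mI HLinf HL0 [_ maxopt] opt0|].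
  apply: (Rmult_le_reg_r opt) => //; rewrite /Rdiv Rmult_assoc Rinv_l; last lra.
  rewrite Rmult_1_r -mI; apply: instance_gap => //; first by rewrite mI.
  move=> T p sp shp; have [T' [fT' <-]] := feasible_nat sp shp.
  exact: maxopt fT'.
have [b [Eb HI]] := gadget_exists hm.
have [I [mI [p0 sp0 c0] [f tf cf] minf rev]] := HI m (leqnSn m).
have a1 := alpha_ge1 hm.
have N0 : (0 < INR (2 ^ m))%R by rewrite INR_exp2; apply: pow_lt; lra.
have AE : INR (2 ^ (m.+1 - m) * b) = (alpha m * INR (2 ^ m))%R.
  have E : (2 ^ m = 2 * 2 ^ m.-1)%R by rewrite -{1}(prednK hm).
  by rewrite subSnn INR_mul Eb !INR_exp2 E pow_1; ring.
have HLinf : is_Linf I (INR (2 ^ (m.+1 - m) * b)).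
  split; first by exists f; rewrite path_cost_zero cf.
  by move=> p /minf /leP/le_INR; rewrite path_cost_zero.
have HL0 : is_L0 I 0.
  split; first by exists p0; rewrite path_cost_zero c0.
  by move=> p _; rewrite path_cost_zero; apply: pos_INR.
exists I, (INR (2 ^ (m.+1 - m) * b)), 0%R, (INR (2 ^ m)).
split; first by exists f.
do 3!split=> //; split; last first.
  by split=> //; rewrite AE; field; lra.
(* If 2^m were not attained, integrality would bound natural revenues by 2^m - 1, and [instance_gap]
   would contradict the toll-free length 2^m alpha(m). *)
split=> //; apply: NNPP => noT.
have := @instance_gap I _ _ (INR (2 ^ m) - 1)%R _ HLinf HL0; rewrite AE mI => /(_ hm) H.
suff: (alpha m * INR (2 ^ m) - 0 <= alpha m * (INR (2 ^ m) - 1))%R by lra.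
apply: H => T p sp shp; rewrite -INR_1 -minus_INR; last by apply/leP; rewrite expn_gt0.
apply/le_INR/leP; rewrite leqNgt; apply/negP => lt.
have [T' [fT' rT']] := feasible_nat sp shp; apply: noT; exists T', p; split=> //.
apply: Rle_antisym; first exact: rev.
by rewrite rT'; apply/le_INR/leP; move: lt; clear; lia.
Qed.
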